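(* Let $P\subset\mathbb{R}^3$ be a $3$-dimensional polytope obtained as a Minkowski sum $P=P_1+\cdots+P_m$ of finitely many polygons $P_1,\dots,P_m\subset\mathbb{R}^3$. If no two distinct summands $P_i,P_j$ ($i\neq j$) share an edge direction, then $P$ is equiprojective.
   Context: A $3$-dimensional polytope $P\subset\mathbb{R}^3$ is $k$-equiprojective when its orthogonal projection onto any plane that is not orthogonal to a facet of $P$ is a polygon with exactly $k$ vertices; it is equiprojective if it is $k$-equiprojective for some $k$. A vector $u\in\mathbb{S}^2$ is an edge direction of a polytope $Q\subset\mathbb{R}^3$ (of any dimension) when its first non-zero coordinate is positive and some edge of $Q$ has its difference of vertices equal to a multiple of $u$. *)

(* Defs.v *)
From HB Require Import structures.
From mathcomp Require Import all_boot all_order all_algebra.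
From mathcomp Require Import classical_sets reals.
Set Implicit Arguments. Unset Strict Implicit. Unset Printing Implicit Defensive.
Import Order.TTheory GRing.Theory Num.Theory.
Local Open Scope ring_scope.
Local Open Scope classical_set_scope.

Section Polytopes.
Variable R : realType.
Notation pt := 'rV[R]_3.

Definition dot (u v : pt) : R := \sum_(i < 3) u ord0 i * v ord0 i.

Definition coord (u : pt) (i : nat) : R := u ord0 (inord i).

Definition conv (s : seq pt) : set pt :=
  [set x | exists w : 'I_(size s) -> R,
     (forall i, 0 <= w i) /\ \sum_i w i = 1 /\ x = \sum_i w i *: s`_i].

Definition polytope (A : set pt) : Prop := exists s : seq pt, A = conv s.

Definition aff_indep (s : seq pt) : Prop :=
  match s with
  | [::] => True
  | p0 :: r => \rank (\matrix_(i < size r) (r`_i - p0)) = size r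
  end.

Definition dim_ge (A : set pt) (d : nat) : Prop :=
  exists s : seq pt, size s = d.+1 /\ (forall x, x \in s -> A x) /\ aff_indep s.

Definition has_dim (A : set pt) (d : nat) : Prop := dim_ge A d /\ ~ dim_ge A d.+1.

Definition polygon (A : set pt) : Prop := polytope A /\ has_dim A 2.

Definition face (A : set pt) (c : pt) : set pt :=
  [set x | A x /\ forall y, A y -> dot c y <= dot c x].
Definition is_face (A F : set pt) : Prop := exists c : pt, F = face A c.
Definition is_vertex (A : set pt) (v : pt) : Prop := is_face A [set v].
Definition is_edge (A E : set pt) : Prop := is_face A E /\ has_dim E 1.
Definition is_facet (A F : set pt) : Prop := is_face A F /\ has_dim F 2.

Definition first_pos (u : pt) : Prop :=
  0 < coord u 0 \/ (coord u 0 = 0 /\ 0 < coord u 1) \/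
  (coord u 0 = 0 /\ coord u 1 = 0 /\ 0 < coord u 2).

Definition edge_direction (Q : set pt) (u : pt) : Prop :=
  dot u u = 1 /\ first_pos u /\
  exists (E : set pt) (a b : pt) (t : R),
    is_edge Q E /\ is_vertex E a /\ is_vertex E b /\ a != b /\ b - a = t *: u.

Definition msum (m : nat) (A : 'I_m -> set pt) : set pt :=
  [set x | exists a : 'I_m -> pt, (forall i, A i (a i)) /\ x = \sum_i a i].

Definition proj (n : pt) (x : pt) : pt := x - (dot x n / dot n n) *: n.

(* the plane with normal n is orthogonal to (the plane of) F:
   some normal c of F is orthogonal to n *)
Definition plane_orth (n : pt) (F : set pt) : Prop :=
  exists c : pt, c != 0 /\ (forall x y, F x -> F y -> dot c (x - y) = 0)
                 /\ dot c n = 0.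

Definition num_vertices (A : set pt) (k : nat) : Prop :=
  exists V : seq pt, uniq V /\ size V = k /\ forall p, p \in V <-> is_vertex A p.

Definition k_equiprojective (P : set pt) (k : nat) : Prop :=
  forall n : pt, n != 0 ->
    ~ (exists F, is_facet P F /\ plane_orth n F) ->
    num_vertices (proj n @` P) k.

Definition equiprojective (P : set pt) : Prop := exists k, k_equiprojective P k.

End Polytopes.

(* Main.v *)
Require Import Defs.
From HB Require Import structures.
From mathcomp Require Import all_boot all_order all_algebra.
From mathcomp Require Import boolp classical_sets reals.
From mathcomp Require Import ring lra.
Set Implicit Arguments.
Unset Strict Implicit.
Import Order.TTheory GRing.Theory Num.Theory.
Local Open Scope ring_scope.
Local Open Scope classical_set_scope.

(** For a direction [n] as in the definition of equiprojectivity, a nonzero [c]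
    orthogonal to [n] never exposes a two-dimensional face of the sum [P].
    Hence each [P_i] projects injectively along [n], and no two edges of
    distinct summands have the same outer normal in the plane orthogonal to [n]
    (such edges would span a facet of [P], or be parallel).  Each edge of each
    summand therefore has its own outer normal ray in that plane, and sending
    it to the last endpoint, in counterclockwise order, of the edge of the
    projection with that normal is a bijection onto the vertices of the
    projection.  The number of vertices is the total number of edges of the
    summands, which does not depend on [n]. *)

(** * Dot and cross products in three-space *)

Section Vectors.
Variable R : realType.
Notation pt := 'rV[R]_3.
Implicit Types u v w x y z c n : pt.

Let x0 (u : pt) : R := u ord0 (@Ordinal 3 0 isT).
Let x1 (u : pt) : R := u ord0 (@Ordinal 3 1 isT).
Let x2 (u : pt) : R := u ord0 (@Ordinal 3 2 isT).

Lemma dotE3 u v : dot u v = x0 u * x0 v + x1 u * x1 v + x2 u * x2 v.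
Proof.
rewrite /dot !big_ord_recl big_ord0 addr0 addrA /x0 /x1 /x2.
by congr (_ * _ + _ * _ + _ * _); congr (fun_of_matrix _ _ _); apply/val_inj.
Qed.

Lemma vec3P u v : x0 u = x0 v -> x1 u = x1 v -> x2 u = x2 v -> u = v.
Proof.
move=> e0 e1 e2; apply/rowP => -[[|[|[|//]]] lti];
  rewrite (bool_irrelevance lti isT) -[0]/ord0.
- exact: e0.
- exact: e1.
- exact: e2.
Qed.

Lemma dotC u v : dot u v = dot v u.
Proof. by apply: eq_bigr => i _; rewrite mulrC. Qed.
Lemma dotDr u v w : dot u (v + w) = dot u v + dot u w.
Proof. by rewrite -big_split; apply: eq_bigr => i _; rewrite mxE mulrDr. Qed.
Lemma dotZr a u v : dot u (a *: v) = a * dot u v.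
Proof. by rewrite /dot big_distrr; apply: eq_bigr => i _; rewrite mxE mulrCA. Qed.
Lemma dotNr u v : dot u (- v) = - dot u v.
Proof. by rewrite -scaleN1r dotZr mulN1r. Qed.
Lemma dotBr u v w : dot u (v - w) = dot u v - dot u w.
Proof. by rewrite dotDr dotNr. Qed.
Lemma dotDl u v w : dot (v + w) u = dot v u + dot w u.
Proof. by rewrite !(dotC _ u) dotDr. Qed.
Lemma dotZl a u v : dot (a *: v) u = a * dot v u.
Proof. by rewrite !(dotC _ u) dotZr. Qed.
Lemma dotNl u v : dot (- v) u = - dot v u.
Proof. by rewrite !(dotC _ u) dotNr. Qed.
Lemma dotBl u v w : dot (v - w) u = dot v u - dot w u.
Proof. by rewrite !(dotC _ u) dotBr. Qed.
Lemma dot0r u : dot u 0 = 0.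
Proof. by rewrite -(scale0r 0) dotZr mul0r. Qed.
Lemma dot0l u : dot 0 u = 0.
Proof. by rewrite dotC dot0r. Qed.
Lemma dot_sumr (I : finType) (P : pred I) u (F : I -> pt) :
  dot u (\sum_(i | P i) F i) = \sum_(i | P i) dot u (F i).
Proof.
by apply: (big_morph (dot u) (id1 := 0)) => [x y|]; rewrite ?dotDr ?dot0r.
Qed.

Lemma dot_gt0 u : u != 0 -> 0 < dot u u.
Proof.
move=> u0; rewrite lt_neqAle sumr_ge0 ?andbT => [|i _]; last by rewrite -expr2 sqr_ge0.
apply: contra u0; rewrite eq_sym psumr_eq0 => [|i _]; last by rewrite -expr2 sqr_ge0.
move=> /allP h; apply/eqP/rowP => i; rewrite mxE.
by have := h i (mem_index_enum _); rewrite mulf_eq0 orbb => /eqP.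
Qed.

Definition cross u v : pt :=
  \row_i [:: x1 u * x2 v - x2 u * x1 v; x2 u * x0 v - x0 u * x2 v;
             x0 u * x1 v - x1 u * x0 v]`_i.

Let cross0 u v : x0 (cross u v) = x1 u * x2 v - x2 u * x1 v.
Proof. by rewrite /x0 mxE. Qed.
Let cross1 u v : x1 (cross u v) = x2 u * x0 v - x0 u * x2 v.
Proof. by rewrite /x1 mxE. Qed.
Let cross2 u v : x2 (cross u v) = x0 u * x1 v - x1 u * x0 v.
Proof. by rewrite /x2 mxE. Qed.
Let crossE := (cross0, cross1, cross2).

Lemma dot_crossl u v : dot u (cross u v) = 0.
Proof. by rewrite dotE3 !crossE; ring. Qed.
Lemma dot_crossr u v : dot v (cross u v) = 0.
Proof. by rewrite dotE3 !crossE; ring. Qed.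
Lemma dot_crossC u v w : dot u (cross v w) = - dot w (cross v u).
Proof. by rewrite !dotE3 !crossE; ring. Qed.
Let xD u v : (x0 (u + v) = x0 u + x0 v) * (x1 (u + v) = x1 u + x1 v)
  * (x2 (u + v) = x2 u + x2 v).
Proof. by rewrite /x0 /x1 /x2 !mxE. Qed.
Let xN u : (x0 (- u) = - x0 u) * (x1 (- u) = - x1 u) * (x2 (- u) = - x2 u).
Proof. by rewrite /x0 /x1 /x2 !mxE. Qed.
Let xZ a u : (x0 (a *: u) = a * x0 u) * (x1 (a *: u) = a * x1 u)
  * (x2 (a *: u) = a * x2 u).
Proof. by rewrite /x0 /x1 /x2 !mxE. Qed.
Let xE := (crossE, xD, xN, xZ).

Lemma crossC u v : cross u v = - cross v u.
Proof. by apply: vec3P; rewrite !xE; ring. Qed.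
Lemma crossvv u : cross u u = 0.
Proof. by apply: vec3P; rewrite !crossE ?/x0 ?/x1 ?/x2 !mxE; ring. Qed.
Lemma crossv0 u : cross u 0 = 0.
Proof. by apply: vec3P; rewrite !crossE ?/x0 ?/x1 ?/x2 !mxE; ring. Qed.
Lemma crossZr a u v : cross u (a *: v) = a *: cross u v.
Proof. by apply: vec3P; rewrite !xE; ring. Qed.
Lemma crossDr u v w : cross u (v + w) = cross u v + cross u w.
Proof. by apply: vec3P; rewrite !xE; ring. Qed.
Lemma crossNr u v : cross u (- v) = - cross u v.
Proof. by apply: vec3P; rewrite !xE; ring. Qed.
Lemma cross_cross u v w : cross u (cross v w) = dot u w *: v - dot u v *: w.
Proof. by apply: vec3P; rewrite !xE !dotE3; ring. Qed.

Lemma cross_eq0 u v : u != 0 -> cross u v = 0 -> v = (dot u v / dot u u) *: u.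
Proof.
move=> u0 e; have uu := dot_gt0 u0; have := cross_cross u u v.
rewrite e crossv0 => /eqP.
rewrite eq_sym subr_eq0 => /eqP h.
by rewrite mulrC -scalerA h scalerA mulVf ?scale1r ?gt_eqF.
Qed.

(** For [c] orthogonal to [n], [cross c (cross n c)] equals [dot c c *: n]. Expanding the cross
    product of [x] with it shows that [x] is parallel to [n]. *)
Lemma orthogonal_to_frame n c x : n != 0 -> c != 0 -> dot c n = 0 ->
  dot c x = 0 -> dot (cross n c) x = 0 -> x = (dot n x / dot n n) *: n.
Proof.
move=> n0 c0 cn cx jx; apply: cross_eq0 => //.
have := cross_cross x c (cross n c).
rewrite (cross_cross c n c) cn scale0r subr0 crossZr ![dot x _]dotC cx jx !scale0r subrr.
move/eqP; rewrite scaler_eq0 gt_eqF ?dot_gt0 //= => /eqP e.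
by rewrite crossC e oppr0.
Qed.

(** Both vectors are multiples of [cross n w]. *)
Lemma orthogonal_pair_unique n w c c' : c != 0 -> cross n w != 0 ->
  dot c n = 0 -> dot c w = 0 -> dot c' n = 0 -> dot c' w = 0 ->
  exists l, c' = l *: c.
Proof.
move=> c0 k0 cn cw c'n c'w.
have par d : dot d n = 0 -> dot d w = 0 -> exists l, d = l *: cross n w.
  move=> dn dw; exists (dot (cross n w) d / dot (cross n w) (cross n w)).
  apply: cross_eq0 => //; have := cross_cross d n w.
  rewrite dn dw !scale0r subrr => e.
  by rewrite crossC e oppr0.
have [l el] := par c cn cw; have [l' el'] := par c' c'n c'w.
exists (l' / l); rewrite el' el scalerA divfK //.
by apply: contra c0; rewrite el => /eqP->; rewrite scale0r.
Qed.

Lemma dot_projl n c x : dot c (proj n x) = dot (proj n c) x.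
Proof. by rewrite /proj !dotBr !dotBl dotZr dotZl (dotC x n) (dotC c n); ring. Qed.

Lemma dot_proj n c : n != 0 -> dot (proj n c) n = 0.
Proof. by move=> n0; rewrite dotBl dotZl divfK ?subrr // gt_eqF ?dot_gt0. Qed.

Lemma projB n x y : proj n (x - y) = proj n x - proj n y.
Proof. by rewrite /proj dotBl mulrBl scalerBl !opprD addrACA. Qed.

End Vectors.

(** * Affine dimension, cross products and normals *)

Section Dimension.
Variable R : realType.
Notation pt := 'rV[R]_3.
Implicit Types (u v w x y z c n p q : pt) (A B : set pt).

Lemma aff_indepP p0 (r : seq pt) : aff_indep (p0 :: r) <->
  forall w : 'rV[R]_(size r), \sum_i w 0 i *: (r`_i - p0) = 0 -> w = 0.
Proof.
have mulE (w : 'rV[R]_(size r)) : w *m (\matrix_(i < size r) (r`_i - p0)) =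
    \sum_i w 0 i *: (r`_i - p0).
  by rewrite mulmx_sum_row; apply: eq_bigr => i _; rewrite rowK.
split=> [/eqP free w|h].
  by rewrite -mulE => /eqP; rewrite (mulmx_free_eq0 _ free) => /eqP.
by apply/eqP/inj_row_free => w; rewrite mulE; apply: h.
Qed.

Lemma cross_free p q a b : cross p q != 0 -> a *: p + b *: q = 0 -> a = 0 /\ b = 0.
Proof.
move=> pq e; split; apply/eqP.
  have := congr1 (cross q) e; rewrite crossDr !crossZr crossvv crossv0.
  rewrite scaler0 addr0 crossC scalerN => /eqP.
  by rewrite oppr_eq0 scaler_eq0 (negbTE pq) orbF.
have := congr1 (cross p) e; rewrite crossDr !crossZr crossvv crossv0.
by rewrite scaler0 add0r => /eqP; rewrite scaler_eq0 (negbTE pq) orbF.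
Qed.

Lemma dim_ge2P A : dim_ge A 2 <->
  exists x y z, [/\ A x, A y, A z & cross (y - x) (z - x) != 0].
Proof.
split=> [[s [sz [As ind]]]|[x [y [z [Ax Ay Az h]]]]].
  case: s sz As ind => [|x [|y [|z [|? ?]]]] // _ As ind.
  have {}ind := (aff_indepP _ _).1 ind.
  exists x, y, z; split; try by apply: As; rewrite !inE eqxx ?orbT.
  apply/eqP => e; case: (eqVneq (y - x) 0) => [yx|yx].
    have := ind (\row_i (i == 0)%:R); rewrite !big_ord_recl big_ord0 !mxE /= yx.
    rewrite scaler0 scale0r !addr0 => /(_ erefl)/rowP/(_ 0).
    by rewrite !mxE eqxx => /eqP; rewrite oner_eq0.
  have := cross_eq0 yx e; set l := _ / _ => zx.
  have := ind (\row_i (if i == 0 then - l else 1)).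
  rewrite !big_ord_recl big_ord0 !mxE /= zx scale1r addr0 scaleNr addNr.
  move=> /(_ erefl)/rowP/(_ (lift ord0 ord0)).
  by rewrite !mxE /= => /eqP; rewrite oner_eq0.
exists [:: x; y; z]; split=> //; split.
  by move=> w; rewrite !inE => /or3P[] /eqP->.
apply/(aff_indepP _ _).2 => w; rewrite !big_ord_recl big_ord0 /= addr0 => e.
have [a0 b0] := cross_free h e.
by apply/rowP => -[[|[|//]] lti]; rewrite mxE; [rewrite -a0 | rewrite -b0];
  congr (w _ _); apply/val_inj.
Qed.

Lemma dim_ge1 A x y : A x -> A y -> x != y -> dim_ge A 1.
Proof.
move=> Ax Ay xy; exists [:: x; y]; split=> //; split.
  by move=> w; rewrite !inE => /orP[] /eqP->.
apply/(aff_indepP _ _).2 => w; rewrite big_ord_recl big_ord0 /= addr0 => /eqP.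
rewrite scaler_eq0 subr_eq0 [y == x]eq_sym (negbTE xy) orbF => /eqP w0.
by apply/rowP => i; rewrite mxE -w0; congr (w _ _); rewrite !ord1; apply/val_inj.
Qed.

(** Four affinely independent points would give an invertible matrix of differences that sends [c]
    to zero. *)
Lemma not_dim_ge3 A c : c != 0 ->
  (forall x y, A x -> A y -> dot c (x - y) = 0) -> ~ dim_ge A 3.
Proof.
move=> c0 flat [s [sz [As]]].
case: s sz As => [|x [|y [|z [|w [|? ?]]]]] // _ As.
have Ax : A x by apply: As; rewrite inE eqxx.
rewrite /aff_indep; set M := (\matrix_i _) => rkM.
have Mu : M \in unitmx by rewrite -row_free_unit; apply/eqP.
have : M *m c^T = 0.
  apply/colP => i; rewrite !mxE.
  rewrite -[RHS](flat ([:: y; z; w]`_i) x) //; last first.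
    by apply: As; rewrite inE; apply/orP; right; apply: mem_nth.
  by rewrite /dot; apply: eq_bigr => j _; rewrite !mxE mulrC.
move/(congr1 (mulmx (invmx M))); rewrite mulKmx // mulmx0 => /(congr1 trmx).
by rewrite trmxK trmx0 => ce; rewrite ce eqxx in c0.
Qed.

(** The cross product of two independent differences is normal to all of [A]: a point off their
    plane would be a fourth affinely independent one. *)
Lemma normal_of_plane A : dim_ge A 2 -> ~ dim_ge A 3 ->
  exists N, N != 0 /\ forall x y, A x -> A y -> dot N (x - y) = 0.
Proof.
move=> /dim_ge2P[x [y [z [Ax Ay Az h]]]] nd.
exists (cross (y - x) (z - x)); split=> //.
suff H w : A w -> dot (cross (y - x) (z - x)) (w - x) = 0.
  move=> u v Au Av; have -> : u - v = (u - x) - (v - x) by rewrite opprB addrA subrK.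
  by rewrite dotBr !H // subrr.
move=> Aw; apply: contrapT => /eqP ne; apply: nd.
exists [:: x; y; z; w]; split=> //; split.
  by move=> t; rewrite !inE => /or4P[] /eqP->.
apply/(aff_indepP _ _).2 => k; rewrite !big_ord_recl big_ord0 /= addr0 => e.
have := congr1 (dot (cross (y - x) (z - x))) e.
rewrite !dotDr !dotZr dot0r ![dot (cross _ _) (y - x)]dotC.
rewrite ![dot (cross _ _) (z - x)]dotC dot_crossl dot_crossr !mulr0 !add0r => /eqP.
rewrite mulf_eq0 (negbTE ne) orbF => /eqP e0.
move: e; rewrite e0 scale0r addr0 => e.
have [a0 b0] := cross_free h e.
by apply/rowP => -[[|[|[|//]]] lti]; rewrite mxE; [rewrite -a0|rewrite -b0|rewrite -e0];
  congr (k _ _); apply/val_inj.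
Qed.

Lemma dim_ge2_translate A B X : (forall x, A x -> B (x + X)) ->
  dim_ge A 2 -> dim_ge B 2.
Proof.
move=> AB /dim_ge2P[x [y [z [Ax Ay Az h]]]]; apply/dim_ge2P.
by exists (x + X), (y + X), (z + X); split; try exact: AB;
  rewrite !opprD ![_ + X + _]addrACA subrr !addr0.
Qed.

End Dimension.

(** * Faces of a Minkowski sum *)

Section MinkowskiSum.
Variables (R : realType) (m : nat) (Ps : 'I_m -> set 'rV[R]_3).
Notation pt := 'rV[R]_3.
Implicit Types (v w x y z c d : pt) (a : 'I_m -> pt).

Lemma sum_exchange1 a i x :
  \sum_k (if k == i then x else a k) = \sum_k a k + (x - a i).
Proof.
rewrite (bigD1 i) //= eqxx [\sum_k a k](bigD1 i) //=.
rewrite (eq_bigr a) => [|k /negbTE->//].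
by rewrite [RHS]addrC addrA subrK.
Qed.

Lemma msum_exchange1 a i x : (forall k, Ps k (a k)) -> Ps i x ->
  msum Ps (\sum_k a k + (x - a i)).
Proof.
move=> Pa Px; exists (fun k => if k == i then x else a k).
by rewrite sum_exchange1; split=> // k; case: eqP => // ->.
Qed.

Lemma face_msum a c : (forall k, face (Ps k) c (a k)) ->
  face (msum Ps) c (\sum_k a k).
Proof.
move=> Fa; split; first by exists a; split=> // k; case: (Fa k).
move=> y [b [Pb ->]]; rewrite !dot_sumr; apply: ler_sum => k _.
by case: (Fa k) => _; apply.
Qed.

(** Replacing the [i]-th term alone stays in the sum, so it cannot increase the value of [c]. *)
Lemma face_summand a c i : (forall k, Ps k (a k)) ->
  face (msum Ps) c (\sum_k a k) -> face (Ps i) c (a i).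
Proof.
move=> Pa [_ Fa]; split=> // y Py.
by have := Fa _ (msum_exchange1 Pa Py); rewrite dotDr dotBr; lra.
Qed.

(** [X] is the sum of fixed maximizers of [c] in the other summands. *)
Lemma face_translate c i : (forall k, exists x, face (Ps k) c x) ->
  exists X, forall x, face (Ps i) c x -> face (msum Ps) c (x + X).
Proof.
move=> /choice[a Fa]; exists (\sum_k a k - a i) => x Fx.
rewrite addrCA -sum_exchange1; apply: face_msum => k.
by case: eqP => [->|].
Qed.

Lemma face_translate2 c i j : i != j -> (forall k, exists x, face (Ps k) c x) ->
  exists X, forall x y, face (Ps i) c x -> face (Ps j) c y ->
    face (msum Ps) c (x + y + X).
Proof.
move=> ij /choice[a Fa]; exists (\sum_k a k - a i - a j) => x y Fx Fy.
have -> : x + y + (\sum_k a k - a i - a j) =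
    \sum_k (if k == j then y else if k == i then x else a k).
  rewrite (sum_exchange1 (fun k => if k == i then x else a k)) sum_exchange1.
  rewrite eq_sym (negbTE ij); apply/rowP => k; rewrite !mxE; ring.
by apply: face_msum => k; case: eqP => [->//|_]; case: eqP => [->|].
Qed.

End MinkowskiSum.

(** A large multiple of the primary values [a] outweighs the secondary values [b]; the sum of all
    ratios is large enough. This turns a lexicographic maximum over finitely many generators into
    the maximum of one linear functional. *)
Lemma lex_bound (R : realType) (T : finType) (P : pred T) (a b : T -> R) :
  (forall t, P t -> a t <= 0) -> (forall t, P t -> a t = 0 -> b t <= 0) ->
  exists r0, forall r, r0 <= r -> forall t, P t -> b t + r * a t <= 0.
Proof.
move=> a_le b_le; exists (\sum_t `|b t / a t|) => r r_ge t Pt.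
have [a0|a0] := eqVneq (a t) 0; first by rewrite a0 mulr0 addr0 b_le.
have: `|b t / a t| <= r.
  apply: le_trans r_ge; rewrite (bigD1 t) //= lerDl; apply: sumr_ge0 => *.
  exact: normr_ge0.
have -> : b t + r * a t = (b t / a t + r) * a t by rewrite mulrDl divfK.
rewrite ler_norml => /andP[h _]; apply: mulr_ge0_le0; [lra | exact: a_le].
Qed.

(** * Finite generating families *)

Section Generators.
Variables (R : realType) (m : nat) (Ps : 'I_m -> set 'rV[R]_3).
Notation pt := 'rV[R]_3.
Variables (T : finType) (g : T -> pt) (tau : T -> 'I_m).

(* [Ps i] enters only through its support function: the points [g t] with
   [tau t = i] belong to it and lie in no smaller half-space. *)
Definition generates : Prop :=
  (forall t, Ps (tau t) (g t)) /\
  forall i (c : pt) r, (forall t, tau t = i -> dot c (g t) <= r) ->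
    forall y, Ps i y -> dot c y <= r.

Hypothesis gen : generates.
Implicit Types (v w x y z c d : pt) (a : 'I_m -> pt) (i : 'I_m).

(** The maximum is taken over the generators. Only linear bounds pass from them to the other points,
    so the pair [c], [d] is merged into the functional [d + r0 *: c]. *)
Lemma generates_lexmax i c d : (exists x, Ps i x) ->
  exists t, tau t = i /\ face (Ps i) c (g t) /\
    forall y, Ps i y -> dot c y = dot c (g t) -> dot d y <= dot d (g t).
Proof.
case: gen => gP gS [x Px].
have [t0 t0i] : exists t, tau t == i.
  (* Without generators, the bound -1 would hold vacuously for the zero functional. *)
  apply: contrapT => no; have := gS i 0 (-1) _ x Px; rewrite dot0l.
  rewrite ler0N1 => h; suff: false by []; apply: h => t /eqP ti.
  by case: no; exists t.
pose t1 := [arg max_(t > t0 | tau t == i) dot c (g t)]%O.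
have [t1i t1M] : tau t1 == i /\ forall t, tau t == i -> dot c (g t) <= dot c (g t1).
  by rewrite /t1; case: arg_maxP.
pose Q t := (tau t == i) && (dot c (g t) == dot c (g t1)).
pose t2 := [arg max_(t > t1 | Q t) dot d (g t)]%O.
have [/andP[t2i /eqP t2c] t2M] : Q t2 /\ forall t, Q t -> dot d (g t) <= dot d (g t2).
  by rewrite /t2; case: arg_maxP => //; rewrite /Q t1i eqxx.
exists t2; split; first exact/eqP.
have cM y : Ps i y -> dot c y <= dot c (g t2).
  by move=> Py; apply: gS Py => t /eqP ti; rewrite t2c t1M.
split; first by split=> //; rewrite -(eqP t2i).
move=> y Py cy.
have [||r0 /(_ r0 (lexx _)) h] := @lex_bound R T (fun t => tau t == i)
   (fun t => dot c (g t - g t2)) (fun t => dot d (g t - g t2)).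
- by move=> t ti; rewrite dotBr subr_le0 t2c t1M.
- move=> t ti /eqP; rewrite dotBr subr_eq0 => /eqP ct.
  by rewrite dotBr subr_le0 t2M // /Q ti ct t2c eqxx.
have : dot (d + r0 *: c) y <= dot (d + r0 *: c) (g t2).
  apply: gS Py => t /eqP /h; rewrite !dotBr !dotDl !dotZl; lra.
by rewrite !dotDl !dotZl cy lerD2r.
Qed.

Lemma generates_msum_le a c : (forall t, dot c (g t - a (tau t)) <= 0) ->
  forall y, msum Ps y -> dot c (y - \sum_i a i) <= 0.
Proof.
case: gen => _ gS h y [b [Pb ->]]; rewrite dotBr !dot_sumr subr_le0.
apply: ler_sum => i _; apply: gS (Pb i) => t ti.
by have := h t; rewrite ti dotBr subr_le0.
Qed.

End Generators.

(** * Edges and their unit directions *)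

Section EdgeDirections.
Variable R : realType.
Notation pt := 'rV[R]_3.
Implicit Types (u v w x y z c : pt).

Lemma first_pos_or_opp w : w != 0 -> first_pos w \/ first_pos (- w).
Proof.
move=> w0; rewrite /first_pos.
have cN k : Defs.coord (- w) k = - Defs.coord w k by rewrite /Defs.coord mxE.
rewrite !cN.
have [h|h|h0] := ltgtP (Defs.coord w 0) 0; [by right; left; lra | by left; left |].
have [h|h|h1] := ltgtP (Defs.coord w 1) 0;
  [by right; right; left; split; lra | by left; right; left |].
have [h|h|h2] := ltgtP (Defs.coord w 2) 0;
  [by right; right; right; split; [lra|split; lra] | by left; right; right |].
case/eqP: w0; apply/rowP => i; rewrite mxE -(inord_val i).
by case: i => [[|[|[|]]]].
Qed.

Lemma unit_direction w : w != 0 ->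
  exists u t, [/\ dot u u = 1, first_pos u & w = t *: u].
Proof.
move=> w0; have ww := dot_gt0 w0; set l := Num.sqrt (dot w w).
have l0 : 0 < l by rewrite sqrtr_gt0.
have ll : l * l = dot w w by rewrite -expr2 sqr_sqrtr // ltW.
have scale v : first_pos v -> first_pos (l^-1 *: v).
  have i0 : 0 < l^-1 by rewrite invr_gt0.
  rewrite /first_pos; have cZ k : Defs.coord (l^-1 *: v) k = l^-1 * Defs.coord v k.
    by rewrite /Defs.coord mxE.
  rewrite !cZ !pmulr_rgt0 //.
  by case=> [|[[-> h]|[-> [-> h]]]]; [left|right; left|right; right]; rewrite ?mulr0.
have nu v : dot v v = dot w w -> dot (l^-1 *: v) (l^-1 *: v) = 1.
  by move=> e; rewrite dotZl dotZr e -ll; field; lra.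
have [f|f] := first_pos_or_opp w0.
  exists (l^-1 *: w), l; split; [exact: nu|exact: scale|].
  by rewrite scalerA divff ?scale1r ?gt_eqF.
exists (l^-1 *: - w), (- l); split; [|exact: scale|].
  by apply: nu; rewrite dotNl dotNr opprK.
by rewrite !scalerN scaleNr opprK scalerA divff ?scale1r ?gt_eqF.
Qed.

Lemma collinear_of_dim A x y z u t : ~ dim_ge A 2 -> A x -> A y -> A z ->
  x != y -> y - x = t *: u -> exists s, z - x = s *: u.
Proof.
move=> nd Ax Ay Az xy e; have yx : y - x != 0 by rewrite subr_eq0 eq_sym.
have /eqP cr : cross (y - x) (z - x) == 0.
  by apply/negP => h; apply: nd; apply/dim_ge2P; exists x, y, z; split=> //; apply/negP.
by have := cross_eq0 yx cr; set s := _ / _; rewrite {1}e scalerA; exists (s * t).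
Qed.

Variables (m : nat) (Ps : 'I_m -> set pt) (T : finType) (g : T -> pt) (tau : T -> 'I_m).
Hypothesis gen : generates Ps g tau.

(** A face with two distinct points that is not two-dimensional lies on a line; the generators on it
    that are extremal for [u] and [- u] are its endpoints. *)
Lemma edge_directionI i c x y u t : face (Ps i) c x -> face (Ps i) c y -> x != y ->
  ~ dim_ge (face (Ps i) c) 2 -> dot u u = 1 -> first_pos u -> y - x = t *: u ->
  edge_direction (Ps i) u.
Proof.
move=> Fx Fy xy nd uu fu e; split=> //; split=> //.
have line z z' : face (Ps i) c z -> face (Ps i) c z' -> z - z' = dot u (z - z') *: u.
  move=> Fz Fz'.
  have [s es] := collinear_of_dim nd Fx Fy Fz xy e.
  have [s' es'] := collinear_of_dim nd Fx Fy Fz' xy e.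
  have -> : z - z' = (s - s') *: u by rewrite scalerBl -es -es' opprB addrA subrK.
  by rewrite dotZr uu mulr1.
have ne : exists p, Ps i p by exists x; case: Fx.
have [ta [_ [Fa Ma]]] := generates_lexmax gen c u ne.
have [tb [_ [Fb Mb]]] := generates_lexmax gen c (- u) ne.
have val z z' : face (Ps i) c z -> face (Ps i) c z' -> dot c z = dot c z'.
  by move=> [Pz Mz] [Pz' Mz']; apply/eqP; rewrite eq_le Mz // Mz'.
have {}Ma z : face (Ps i) c z -> dot u z <= dot u (g ta).
  by move=> Fz; apply: Ma; [case: Fz | apply: val].
have {}Mb z : face (Ps i) c z -> dot u (g tb) <= dot u z.
  move=> Fz; rewrite -lerN2 -!dotNl; apply: Mb; [by case: Fz | exact: val].
have eqd z z' : face (Ps i) c z -> face (Ps i) c z' -> dot u z = dot u z' -> z = z'.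
  move=> Fz Fz' h; apply/eqP; rewrite -subr_eq0 (line z z') // dotBr h subrr.
  by rewrite scale0r.
exists (face (Ps i) c), (g ta), (g tb), (dot u (g tb - g ta)); split.
  by split; [exists c | split; [exact: dim_ge1 xy | ]].
split.
  exists u; apply/seteqP; split=> z /=; first by move=> ->; split.
  by case=> Fz Mz; apply: eqd => //; apply/eqP; rewrite eq_le Ma // Mz.
split.
  exists (- u); apply/seteqP; split=> z /=.
    by move=> ->; split=> // z' Fz'; rewrite !dotNl lerN2 Mb.
  case=> Fz Mz; apply: eqd => //; apply/eqP; rewrite eq_le Mb // andbT.
  by have := Mz _ Fb; rewrite !dotNl lerN2.
split; last exact: line.
apply: contra xy => /eqP ab; apply/eqP; apply: eqd => //.
have := Ma _ Fx; have := Ma _ Fy; have := Mb _ Fx; have := Mb _ Fy.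
by rewrite ab; lra.
Qed.

End EdgeDirections.

(** * Coordinates in the plane orthogonal to [n] *)

Section ProjectionFrame.
Variables (R : realType) (n : 'rV[R]_3).
Hypothesis n0 : n != 0.
Notation pt := 'rV[R]_3.
Implicit Types (x y c : pt).

Lemma proj_eqP x y : proj n x = proj n y <-> exists s, x - y = s *: n.
Proof.
split=> [/eqP|[s e]].
  by rewrite -subr_eq0 -projB subr_eq0 => /eqP h; eexists; exact: h.
apply/eqP; rewrite -subr_eq0 -projB e /proj dotZl mulfK ?subrr //.
by rewrite gt_eqF ?dot_gt0.
Qed.

Lemma proj_eq_frame c x y : c != 0 -> dot c n = 0 -> dot c (x - y) = 0 ->
  dot (cross n c) (x - y) = 0 -> proj n x = proj n y.
Proof.
by move=> *; apply/proj_eqP; eexists; apply: (@orthogonal_to_frame _ n c).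
Qed.

Lemma proj_eq_dot c x y : dot c n = 0 -> proj n x = proj n y -> dot c x = dot c y.
Proof.
move=> cn /proj_eqP[s e]; apply/eqP; rewrite -subr_eq0 -dotBr e dotZr cn.
by rewrite mulr0.
Qed.

Lemma cross_cross_orth c : dot c n = 0 -> cross n (cross n c) = - (dot n n *: c).
Proof. by move=> cn; rewrite cross_cross dotC cn scale0r sub0r. Qed.

Lemma cross_neq0 c : c != 0 -> dot c n = 0 -> cross n c != 0.
Proof.
move=> c0 cn; apply/eqP => h; have := cross_cross_orth cn.
rewrite h crossv0 => /esym/eqP; rewrite oppr_eq0 scaler_eq0 (negbTE c0) orbF.
by rewrite gt_eqF ?dot_gt0.
Qed.

(** The remainder [z] is orthogonal to [c], to [cross n c] and to [n], hence zero. *)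
Lemma frame_decomposition c c' : c != 0 -> dot c n = 0 -> dot c' n = 0 ->
  exists l, c' = l *: c + (dot c' (cross n c) / dot (cross n c) (cross n c)) *: cross n c.
Proof.
move=> c0 cn c'n; have j0 := cross_neq0 c0 cn.
exists (dot c' c / dot c c); set l := _ / dot c c; set b := _ / _.
have cj : dot c (cross n c) = 0 by exact: dot_crossr.
have nj : dot n (cross n c) = 0 by exact: dot_crossl.
apply/eqP; rewrite -subr_eq0 opprD addrA; apply/eqP; set z := _ - _.
rewrite (@orthogonal_to_frame _ n c z) //.
- suff -> : dot n z = 0 by rewrite mul0r scale0r.
  by rewrite /z !dotBr !dotZr nj ![dot n _]dotC cn c'n; ring.
- rewrite /z !dotBr !dotZr cj /l (dotC c c'); field.
  by rewrite gt_eqF ?dot_gt0.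
- rewrite /z !dotBr !dotZr (dotC _ c) cj /b (dotC _ c'); field.
  by rewrite gt_eqF ?dot_gt0.
Qed.

End ProjectionFrame.

(** * Edges of the summands and vertices of the projection *)

Section VertexCount.
Variables (R : realType) (m : nat) (Ps : 'I_m -> set 'rV[R]_3).
Notation pt := 'rV[R]_3.
Variables (T : finType) (g : T -> pt) (tau : T -> 'I_m).
Implicit Types (v w x y z c d : pt) (a : 'I_m -> pt) (i : 'I_m) (E : {set T}).

Definition argmax_set i c : {set T} :=
  [set t | (tau t == i) &&
     [forall t', (tau t' == i) ==> (dot c (g t') <= dot c (g t))]]%SET.

(** Points are compared rather than indices, since a generating family may repeat a point. *)
Definition two_points E := exists t t', [/\ t \in E, t' \in E & g t != g t'].

(* An edge of [Ps i] is encoded by the set of generators lying on it. *)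
Definition edge_set E : Prop :=
  exists i c, [/\ E = argmax_set i c, two_points E & exists t, tau t = i /\ t \notin E].

Hypothesis gen : generates Ps g tau.
Hypothesis dim2 : forall i, dim_ge (Ps i) 2.
Hypothesis ndim3 : forall i, ~ dim_ge (Ps i) 3.
Hypothesis no_shared : forall i j : 'I_m, i != j ->
  ~ (exists u : pt, edge_direction (Ps i) u /\ edge_direction (Ps j) u).
Hypothesis m_gt0 : (0 < m)%N.

Lemma in_argmax_set i c t :
  t \in argmax_set i c <-> tau t = i /\ face (Ps i) c (g t).
Proof.
have [gP gS] := gen; rewrite inE; split.
  move=> /andP[/eqP <- /forallP h]; split=> //; split=> // y Py.
  by apply: gS Py => t' /eqP; exact/implyP.
case=> <- [_ h]; rewrite eqxx; apply/forallP => t'; apply/implyP => /eqP e.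
by apply: h; rewrite -e.
Qed.

Lemma argmax_setZ i c (l : R) : 0 < l -> argmax_set i (l *: c) = argmax_set i c.
Proof.
move=> l0; apply/setP => t; rewrite !inE; congr (_ && _).
by apply: eq_forallb => t'; rewrite !dotZl ler_pM2l.
Qed.

Lemma summand_nonempty i : exists x, Ps i x.
Proof. by have /dim_ge2P[x [_ [_ [Px _ _ _]]]] := dim2 i; exists x. Qed.

Lemma face_nonempty c i : exists x, face (Ps i) c x.
Proof.
by have [t [_ [h _]]] := generates_lexmax gen c 0 (summand_nonempty i); exists (g t).
Qed.

Variable n : pt.
Hypothesis n0 : n != 0.
Hypothesis generic : forall c, c != 0 -> dot c n = 0 -> ~ dim_ge (face (msum Ps) c) 2.

(** The face of the sum contains a translate of the face of each summand. *)
Lemma face_not_dim_ge2 c i : c != 0 -> dot c n = 0 -> ~ dim_ge (face (Ps i) c) 2.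
Proof.
move=> c0 cn h; apply: (generic c0 cn).
have [X FX] := face_translate i (face_nonempty c).
exact: dim_ge2_translate FX h.
Qed.

(** A normal of [Ps i] orthogonal to [n] would have the whole two-dimensional [Ps i] as its face. *)
Lemma normal_transversal i :
  exists N, dot N n != 0 /\ forall x y, Ps i x -> Ps i y -> dot N (x - y) = 0.
Proof.
have [N [N0 flat]] := normal_of_plane (dim2 i) (@ndim3 i); exists N; split=> //.
apply/eqP => Nn; apply: (face_not_dim_ge2 (i := i) N0 Nn).
apply: (@dim_ge2_translate _ (Ps i) _ 0) => // x Px; rewrite addr0; split=> // y Py.
by rewrite -subr_le0 -dotBr flat.
Qed.

Lemma proj_inj_summand i x y : Ps i x -> Ps i y -> proj n x = proj n y -> x = y.
Proof.
move=> Px Py /(proj_eqP n0)[s e]; have [N [Nn flat]] := normal_transversal i.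
have := flat _ _ Px Py; rewrite e dotZr => /eqP; rewrite mulf_eq0 (negbTE Nn) orbF.
move=> /eqP s0; apply/eqP; rewrite -subr_eq0 e s0 scale0r //.
Qed.

(** If all generators maximized [c], this functional would be constant on [Ps i], and the polygon
    would be a two-dimensional face of itself. *)
Lemma argmax_set_proper i c : c != 0 -> dot c n = 0 ->
  exists t, tau t = i /\ t \notin argmax_set i c.
Proof.
move=> c0 cn; apply: contrapT => no; have [gP gS] := gen.
apply: (face_not_dim_ge2 (i := i) c0 cn).
apply: (@dim_ge2_translate _ (Ps i) _ 0) => // x Px; rewrite addr0; split=> // y Py.
have allF t : tau t = i -> face (Ps i) c (g t).
  move=> ti; have /in_argmax_set[] // : t \in argmax_set i c.
  by apply: contrapT => /negP h; apply: no; exists t.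
have [t [ti [_ _]]] := generates_lexmax gen c 0 (summand_nonempty i).
have [_ My] := allF t ti; apply: (le_trans (My y Py)).
rewrite -lerN2 -!dotNl; apply: gS Px => t' t'i; rewrite !dotNl lerN2.
by have [_] := allF t' t'i; apply; rewrite -ti.
Qed.

(** * Outer normals of edges in the plane orthogonal to [n] *)

Definition outer_normal E c : Prop :=
  [/\ c != 0, dot c n = 0, two_points E & exists i, E = argmax_set i c].

Lemma outer_normal_edge E c : outer_normal E c -> edge_set E.
Proof.
move=> [c0 cn E2 [i Ei]]; exists i, c; split=> //.
by rewrite Ei; exact: argmax_set_proper.
Qed.

(** Adding a multiple of the normal [N] of the polygon changes no comparison between its points. As
    [N] is not orthogonal to [n], a suitable multiple makes [c] orthogonal to [n]. *)
Lemma edge_outer_normal E : edge_set E -> exists c, outer_normal E c.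
Proof.
move=> [i [c [Ei E2 [t [ti tE]]]]]; have [N [Nn flat]] := normal_transversal i.
have [gP gS] := gen.
pose c' := c - (dot c n / dot N n) *: N; exists c'.
have EE : E = argmax_set i c'.
  rewrite Ei; apply/setP => s; rewrite !inE; case: eqP => //= si.
  apply: eq_forallb => s'; case: eqP => //= s'i.
  have := flat (g s) (g s'); rewrite -{1}si -s'i => /(_ (gP _) (gP _)).
  by rewrite dotBr => /subr0_eq e; rewrite !dotBl !dotZl e lerD2r.
split=> //; last by exists i.
  apply: contraNN tE => /eqP c'0; rewrite EE c'0 inE ti eqxx /=.
  by apply/forallP => s; rewrite !dot0l lexx implybT.
by rewrite dotBl dotZl divfK ?subrr.
Qed.

(* Two edges with the same outer normal would span a facet of the sum, unless
   they are parallel, which the hypothesis on edge directions rules out. *)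
Lemma outer_normal_inj E E' c : outer_normal E c -> outer_normal E' c -> E = E'.
Proof.
move=> [c0 cn [t1 [t2 [t1E t2E t12]]] [i Ei]] [_ _ [s1 [s2 [s1E s2E s12]]] [j Ej]].
have [ij|ij] := eqVneq i j; first by rewrite Ei Ej ij.
move: t1E t2E; rewrite Ei => /in_argmax_set[_ F1] /in_argmax_set[_ F2].
move: s1E s2E; rewrite Ej => /in_argmax_set[_ G1] /in_argmax_set[_ G2].
have w0 : g t2 - g t1 != 0 by rewrite subr_eq0 eq_sym.
have [u [l [uu fu e]]] := unit_direction w0.
have di : edge_direction (Ps i) u.
  by apply: (edge_directionI gen F1 F2 t12 _ uu fu e); exact: face_not_dim_ge2.
exfalso; apply: (no_shared ij); exists u; split=> //.
have [X FX] := face_translate2 ij (face_nonempty c).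
have ne : g t1 + g s1 + X != g t2 + g s1 + X.
  by rewrite !(inj_eq (addIr _)).
have sub3 (p q r : pt) : p + r + X - (q + r + X) = p - q.
  by rewrite opprD addrACA subrr addr0 opprD addrACA subrr addr0.
have [|s es] := collinear_of_dim (generic c0 cn) (FX _ _ F1 G1) (FX _ _ F2 G1)
  (FX _ _ F1 G2) ne (t := l) (u := u); first by rewrite sub3.
have es2 : g s2 - g s1 = s *: u by rewrite -es ![g t1 + _]addrC sub3.
by apply: (edge_directionI gen G1 G2 s12 _ uu fu es2); exact: face_not_dim_ge2.
Qed.

Lemma outer_normalZ E c (l : R) : 0 < l -> outer_normal E c -> outer_normal E (l *: c).
Proof.
move=> l0 [c0 cn E2 [i Ei]]; split=> //; first by rewrite scaler_eq0 negb_or gt_eqF.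
  by rewrite dotZl cn mulr0.
by exists i; rewrite argmax_setZ.
Qed.

(** Both normals are orthogonal to [n] and to the edge, hence proportional; a generator off the edge
    fixes the sign of the factor. *)
Lemma outer_normal_unique E c c' : outer_normal E c -> outer_normal E c' ->
  exists l : R, 0 < l /\ c' = l *: c.
Proof.
move=> [c0 cn E2 [i Ei]] [c'0 c'n [t1 [t2 [t1E t2E t12]]] [j Ej]].
have [t1i F1] : tau t1 = i /\ face (Ps i) c (g t1) by apply/in_argmax_set; rewrite -Ei.
have [t2i F2] : tau t2 = i /\ face (Ps i) c (g t2) by apply/in_argmax_set; rewrite -Ei.
have [t1j G1] : tau t1 = j /\ face (Ps j) c' (g t1) by apply/in_argmax_set; rewrite -Ej.
have [t2j G2] : tau t2 = j /\ face (Ps j) c' (g t2) by apply/in_argmax_set; rewrite -Ej.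
have eij : j = i by rewrite -t1i.
rewrite {}eij in Ej t1j G1 t2j G2.
have perp d : face (Ps i) d (g t1) -> face (Ps i) d (g t2) -> dot d (g t1 - g t2) = 0.
  move=> [P1 M1] [P2 M2]; apply/eqP; rewrite dotBr subr_eq0 eq_le M1 // M2 //.
have [|l el] := @orthogonal_pair_unique _ n (g t1 - g t2) c c' c0 _ cn (perp _ F1 F2)
  c'n (perp _ G1 G2).
  apply/eqP => h; case/eqP: t12; apply: (@proj_inj_summand i); [by case: F1|by case: F2|].
  by apply/proj_eqP => //; eexists; exact: (cross_eq0 n0 h).
exists l; split=> //.
have [t [ti tE]] := argmax_set_proper i c0 cn.
have [gP gS] := gen.
have Pt : Ps i (g t) by rewrite -ti.
have lt d : E = argmax_set i d -> dot d (g t) < dot d (g t1).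
  move=> Ed; have [_ [_ M]] : tau t1 = i /\ face (Ps i) d (g t1).
    by apply/in_argmax_set; rewrite -Ed.
  rewrite lt_neqAle M // andbT; apply: contra tE => /eqP e; rewrite -Ei Ed.
  by apply/in_argmax_set; split=> //; split=> // y Py; rewrite e M.
have := lt c Ei; have := lt c' Ej; rewrite el !dotZl => h h'.
rewrite ltNge; apply/negP => l0.
by have := ler_wnM2l l0 (ltW h'); rewrite leNgt h.
Qed.

(** For [c] orthogonal to [n], [cross n c] is [c] after a counterclockwise quarter turn, up to
    scale. Ties for [c] are thus broken in favour of the last endpoint. *)
Definition lexmax c v : Prop := msum Ps v /\ forall y, msum Ps y ->
  dot c y <= dot c v /\
  (dot c y = dot c v -> dot (cross n c) y <= dot (cross n c) v).

Lemma lexmaxZ c v (l : R) : 0 < l -> lexmax c v -> lexmax (l *: c) v.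
Proof.
move=> l0 [Pv h]; split=> // y /h[h1 h2].
rewrite crossZr !dotZl !ler_pM2l //; split=> //.
by move=> /(mulfI (lt0r_neq0 l0)).
Qed.

(** Lexicographic maximizers of the summands are added up: equality of the sums of [c]-values forces
    equality in each summand. *)
Lemma lexmax_exists c : exists v, lexmax c v.
Proof.
have /choice[t ht] i := generates_lexmax gen c (cross n c) (summand_nonempty i).
have Pt i : Ps i (g (t i)) by have [_ [[]]] := ht i.
exists (\sum_i g (t i)); split; first by exists (g \o t).
move=> y [b [Pb ->]]; rewrite !dot_sumr.
have le i : dot c (b i) <= dot c (g (t i)) by have [_ [[_ h] _]] := ht i; exact: h.
split; first exact: ler_sum.
move=> e; apply: ler_sum => i _; have [_ [_ h]] := ht i; apply: h => //.
have: \sum_k (dot c (g (t k)) - dot c (b k)) == 0 by rewrite sumrB e subrr.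
rewrite psumr_eq0 => [/allP/(_ i)|k _]; last by rewrite subr_ge0.
by rewrite mem_index_enum subr_eq0 => /(_ isT)/eqP.
Qed.

Lemma lexmax_unique c v v' : c != 0 -> dot c n = 0 ->
  lexmax c v -> lexmax c v' -> proj n v = proj n v'.
Proof.
move=> c0 cn [Pv Mv] [Pv' Mv']; have [h1 h2] := Mv _ Pv'; have [h3 h4] := Mv' _ Pv.
have e : dot c v = dot c v' by apply/eqP; rewrite eq_le h1 h3.
apply: (proj_eq_frame n0 c0 cn); rewrite dotBr; first by rewrite e subrr.
by apply/eqP; rewrite subr_eq0 eq_le h2 // h4.
Qed.

Lemma lexmax_proj c v v' : dot c n = 0 -> proj n v = proj n v' -> msum Ps v ->
  lexmax c v' -> lexmax c v.
Proof.
move=> cn e Pv [_ M]; split=> // y /M.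
have jn : dot (cross n c) n = 0 by rewrite dotC dot_crossl.
by rewrite (proj_eq_dot n0 cn e) (proj_eq_dot n0 jn e).
Qed.

(** The point [v] maximizes [cross n c + r *: c] for every large [r], that is, for [c] tilted
    slightly counterclockwise. *)
Lemma lexmax_vertex c v : c != 0 -> dot c n = 0 -> lexmax c v ->
  is_vertex (proj n @` msum Ps) (proj n v).
Proof.
move=> c0 cn [Pv Mv]; have [a [Pa ev]] := Pv; have [gP gS] := gen.
have Px t : msum Ps (v + (g t - a (tau t))) by rewrite ev; exact: msum_exchange1.
have [||r0 hr] := @lex_bound R T xpredT (fun t => dot c (g t - a (tau t)))
   (fun t => dot (cross n c) (g t - a (tau t))).
- by move=> t _; have [] := Mv _ (Px t); rewrite dotDr gerDl.
- move=> t _ e; have [_] := Mv _ (Px t); rewrite (dotDr c v) e addr0 => /(_ erefl).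
  by rewrite dotDr gerDl.
have le r y : r0 <= r -> msum Ps y -> dot (cross n c + r *: c) (y - v) <= 0.
  move=> r0r; rewrite ev; apply: (generates_msum_le gen) => t.
  by rewrite dotDl dotZl; exact: hr.
have jn : dot (cross n c) n = 0 by rewrite dotC dot_crossl.
(* Going strictly beyond [r0] gives uniqueness: a tie at [r0 + 1], with the bound at [r0], forces
   equal [c]-values. *)
pose c' := cross n c + (r0 + 1) *: c.
have c'n : dot c' n = 0 by rewrite dotDl dotZl cn jn; ring.
have c'p y : dot c' (proj n y) = dot c' y.
  by rewrite /proj dotBr dotZr c'n; ring.
exists c'; apply/seteqP; split=> z /=.
  move=> ->; split; first by exists v.
  move=> _ [y Py <-]; rewrite !c'p -subr_le0 -dotBr; apply: le => //; lra.
case=> -[y Py <-] Mz.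
have := Mz (proj n v) (ex_intro2 _ _ v Pv erefl); rewrite !c'p => h.
have h1 := le r0 y (lexx _) Py.
have [h2 _] := Mv y Py.
move: h h1; rewrite /c' !dotDl !dotZl !dotBr => h h1.
have ce : dot c y = dot c v by lra.
have [_ /(_ ce) h3] := Mv y Py.
by apply: (proj_eq_frame n0 c0 cn); rewrite dotBr; move: h; rewrite ce; lra.
Qed.

(** Moving only the [i]-th term along its edge keeps the value of [c]. The other value strictly
    drops because projection is injective on [Ps i]. *)
Lemma outer_normal_lexmax_edge E c v : outer_normal E c -> lexmax c v ->
  exists y, [/\ msum Ps y, dot c (y - v) = 0 & dot (cross n c) (y - v) < 0].
Proof.
move=> [c0 cn [t1 [t2 [t1E t2E t12]]] [i Ei]] [Pv Mv]; have [a [Pa ev]] := Pv.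
have Fv : face (msum Ps) c (\sum_k a k).
  by rewrite -ev; split=> // y /Mv[].
have [Pai Mai] := face_summand i Pa Fv.
have [x Fx xa] : exists2 x, face (Ps i) c x & x != a i.
  move: t1E t2E; rewrite Ei => /in_argmax_set[_ F1] /in_argmax_set[_ F2].
  have [e|] := eqVneq (g t1) (a i); last by exists (g t1).
  by exists (g t2) => //; rewrite -e eq_sym.
have [Px Mx] := Fx.
have Py := msum_exchange1 Pa Px; rewrite -ev in Py.
exists (v + (x - a i)); rewrite addrAC subrr add0r.
have ce : dot c (x - a i) = 0.
  by apply/eqP; rewrite dotBr subr_eq0 eq_le Mx // Mai.
split=> //; have [_] := Mv _ Py; rewrite (dotDr c v) ce addr0 => /(_ erefl).
rewrite (dotDr _ v) gerDl lt_neqAle => ->; rewrite andbT; apply: contra xa => /eqP je.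
apply/eqP; apply: (@proj_inj_summand i) => //.
exact: (proj_eq_frame n0 c0 cn).
Qed.

(* At a common vertex each edge forces the other normal to be turned
   counterclockwise from its own, so the two normals are parallel. *)
Lemma lexmax_inj E E' c c' v v' : outer_normal E c -> outer_normal E' c' ->
  lexmax c v -> lexmax c' v' -> proj n v = proj n v' -> E = E'.
Proof.
move=> oE oE' Lv Lv' pe.
have [c0 cn E2 [i Ei]] := oE; have [c'0 c'n _ _] := oE'.
have {Lv'}L'v : lexmax c' v by case: Lv => Pv _; apply: lexmax_proj Lv'.
have turn F d d' : outer_normal F d -> dot d' n = 0 -> lexmax d v -> lexmax d' v ->
    0 <= dot d' (cross n d).
  move=> oF d'n Ld [_ Md']; have [d0 dn _ _] := oF.
  have [y [Py e lt]] := outer_normal_lexmax_edge oF Ld.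
  have [+ _] := Md' y Py; rewrite -subr_le0 -dotBr.
  have [l ->] := frame_decomposition n0 d0 dn d'n; set J := cross n d.
  have JJ : 0 < dot J J by apply: dot_gt0; exact: cross_neq0.
  rewrite !dotDl !dotZl e mulr0 add0r nmulr_lle0 // => h.
  rewrite (dot_crossr n d) mulr0 add0r.
  exact: mulr_ge0 (ltW JJ).
have h1 := turn _ _ _ oE c'n Lv L'v; have h2 := turn _ _ _ oE' cn L'v Lv.
have h3 : dot c' (cross n c) = 0 by move: h2; rewrite dot_crossC; lra.
have [l el] := frame_decomposition n0 c0 cn c'n.
rewrite h3 mul0r scale0r addr0 in el.
have [l0|l0|l0] := ltgtP 0 l.
- apply: (@outer_normal_inj _ _ c') => //; rewrite el; exact: outer_normalZ.
(* Opposite normals: [v] would maximize both [c] and a negative multiple of it, so [c] would be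
   constant on [Ps i]. *)
- have [t [ti tE]] := argmax_set_proper i c0 cn; have [gP gS] := gen.
  have [Pv Mv] := Lv; have [a [Pa ev]] := Pv.
  have flat x : Ps i x -> dot c x = dot c (a i).
    move=> Px; have Py := msum_exchange1 Pa Px; rewrite -ev in Py.
    have [h _] := Mv _ Py; have [_ Mv'] := L'v; have [h' _] := Mv' _ Py.
    move: h h'; rewrite el !dotZl ler_nM2l // !dotDr !dotNr; lra.
  case/negP: tE; apply/in_argmax_set; split=> //.
  have Pt : Ps i (g t) by rewrite -ti.
  by split=> // y Py; rewrite !flat.
- by move: c'0; rewrite el -l0 scale0r eqxx.
Qed.

(** A functional exposing the vertex is rotated clockwise until it becomes an outer normal of some
    edge of a summand. *)
Lemma vertex_lexmax p : is_vertex (proj n @` msum Ps) p ->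
  exists E c v, [/\ outer_normal E c, lexmax c v & p = proj n v].
Proof.
move=> [c1 ec1]; pose c0 := proj n c1; have [gP gS] := gen.
have c0n : dot c0 n = 0 by exact: dot_proj.
have : face (proj n @` msum Ps) c1 p by rewrite -ec1.
case=> -[v Pv ep] Mp; have [a [Pa ev]] := Pv.
have Mv y : msum Ps y -> dot c0 y <= dot c0 v.
  move=> Py; rewrite -!dot_projl ep; apply: Mp; by exists y.
have Uv y : msum Ps y -> dot c0 y = dot c0 v -> proj n y = p.
  move=> Py e; suff : face (proj n @` msum Ps) c1 (proj n y) by rewrite -ec1.
  split; first by exists y.
  by move=> z Pz; rewrite dot_projl -/c0 e -dot_projl ep; exact: Mp.
(* Uniqueness of the maximizer passes from the projection to each summand by exchanging one term. *)
have Ui i y : Ps i y -> dot c0 (y - a i) = 0 -> y = a i.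
  move=> Py e; have Py' := msum_exchange1 Pa Py; rewrite -ev in Py'.
  have := Uv _ Py'; rewrite (dotDr _ v) e addr0 => /(_ erefl); rewrite -ep.
  move=> /(proj_eqP n0)[s]; rewrite addrAC subrr add0r => es.
  by apply: (@proj_inj_summand i) => //; apply/(proj_eqP n0); exists s.
have Mi t : dot c0 (g t - a (tau t)) <= 0.
  have Py' := msum_exchange1 Pa (gP t); rewrite -ev in Py'.
  by have := Mv _ Py'; rewrite (dotDr _ v) gerDl.
pose X t := g t - a (tau t).
pose i0 := Ordinal m_gt0.
(* Otherwise every generator of the first summand equals [a i0], and that polygon is a single
   point. *)
have [t0 t0X] : exists t, dot c0 (X t) != 0.
  apply: contrapT => no; have /dim_ge2P[x [y [z [Px Py Pz]]]] := dim2 i0.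
  have gE t : tau t = i0 -> g t = a i0.
    move=> ti; rewrite -ti; apply: Ui => //; apply/eqP/negP => h.
    by apply: no; exists t; exact/negP.
  have single w : Ps i0 w -> w = a i0.
    move=> Pw; apply/eqP; rewrite -subr_eq0; apply/negP => /negP /dot_gt0.
    set d := {1}(w - a i0); rewrite dotBr subr_gt0 ltNge => /negP; apply.
    by apply: gS Pw => t /gE ->.
  by rewrite (single x) // (single y) // subrr (crossC 0) crossv0 oppr0 eqxx.
have c00 : c0 != 0 by apply: contraNneq t0X => ->; rewrite dot0l.
(* [r *: c0 - cross n c0], for the largest [q t], is the first direction that
   becomes normal to an edge at [v] when [c0] is rotated clockwise. *)
pose q t := dot (cross n c0) (X t) / dot c0 (X t).
pose t1 := [arg max_(t > t0 | dot c0 (X t) != 0) q t]%O.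
have [t1X t1M] : dot c0 (X t1) != 0 /\ forall t, dot c0 (X t) != 0 -> q t <= q t1.
  by rewrite /t1; case: arg_maxP.
pose r := q t1; pose c := r *: c0 - cross n c0.
have jn : dot (cross n c0) n = 0 by rewrite dotC dot_crossl.
have cn : dot c n = 0 by rewrite dotBl dotZl c0n jn; ring.
have cX t : dot c (X t) <= 0.
  have [e|ne] := eqVneq (dot c0 (X t)) 0.
    have -> : X t = 0 by apply/eqP; rewrite subr_eq0; apply/eqP; apply: Ui => //.
    by rewrite dot0r.
  have -> : dot c (X t) = (r - q t) * dot c0 (X t).
    by rewrite /c dotBl dotZl /q; field.
  by apply: mulr_ge0_le0; [rewrite subr_ge0 t1M | exact: Mi].
have cX1 : dot c (X t1) = 0 by rewrite /c dotBl dotZl /r /q; field.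
have cne0 : c != 0.
  have := dot_gt0 (cross_neq0 n0 c00 c0n) => JJ; apply/eqP => h.
  have := congr1 (dot (cross n c0)) h.
  by rewrite dot0r /c dotBr dotZr (dotC _ c0) dot_crossr; lra.
have Mc y : msum Ps y -> dot c (y - v) <= 0.
  by rewrite ev; exact: (generates_msum_le gen).
have jc : cross n c = r *: cross n c0 + dot n n *: c0.
  by rewrite /c crossDr crossZr crossNr cross_cross_orth // opprK.
exists (argmax_set (tau t1) c), c, v; split=> //; last first.
  split=> // y Py; rewrite -subr_le0 -dotBr; split; first exact: Mc.
  move=> /eqP; rewrite -subr_eq0 -dotBr /c dotBl dotZl subr_eq0 => /eqP e.
  (* With [s] the value of [c0] at [y - v], the goal amounts to [(r ^+ 2 + dot n n) * s <= 0], where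
     [s <= 0]. *)
  rewrite -subr_le0 -dotBr jc dotDl !dotZl -e.
  have := Mv y Py; rewrite -subr_le0 -dotBr; have := dot_gt0 n0.
  set s := dot c0 _ => nn s0; have := sqr_ge0 r; nra.
have Fa : face (Ps (tau t1)) c (a (tau t1)).
  split=> // y Py; apply: gS Py => t ti.
  by have := cX t; rewrite /X dotBr subr_le0 ti.
split=> //; last by exists (tau t1).
(* The second point of the edge is [a (tau t1)] itself, which is a generator since some generator
   maximizes [c0]. *)
have [t2 [t2i [[_ M2] _]]] := generates_lexmax gen c0 0 (summand_nonempty (tau t1)).
have t2a : g t2 = a (tau t1).
  apply: Ui; first by rewrite -t2i.
  by apply/eqP; rewrite dotBr subr_eq0 eq_le M2 // andbT -subr_le0 -dotBr -t2i Mi.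
exists t1, t2; split.
- apply/in_argmax_set; split=> //; split=> // y Py.
  have [_ h] := Fa; rewrite (le_trans (h _ Py)) // -subr_ge0 -dotBr cX1 //.
- by apply/in_argmax_set; split=> //; rewrite t2a.
- rewrite t2a -subr_eq0; apply: contraNneq t1X => h; rewrite /X h dot0r //.
Qed.

Lemma num_vertices_proj :
  num_vertices (proj n @` msum Ps) #|[set E | `[< edge_set E >]]%SET|.
Proof.
(* Each edge receives a lexicographic maximizer for one of its normals; other sets receive the
   default 0. *)
have /choice[f fP] E : exists v, edge_set E -> exists2 c, outer_normal E c & lexmax c v.
  have [/edge_outer_normal[c oE]|no] := pselect (edge_set E); last by exists 0.
  by have [v Lv] := lexmax_exists c; exists v => _; exists c.
have inS E : (E \in enum [set E | `[< edge_set E >]]%SET) -> edge_set E.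
  by rewrite mem_enum inE => /asboolP.
exists [seq proj n (f E) | E <- enum [set E | `[< edge_set E >]]%SET]; split; last split.
- rewrite map_inj_in_uniq ?enum_uniq // => E E' /inS/fP[c oE L] /inS/fP[c' oE' L'].
  exact: lexmax_inj oE oE' L L'.
- by rewrite size_map cardE.
move=> p; split=> [/mapP[E /inS/fP[c [c0 cn _ _] L] ->]|].
  exact: lexmax_vertex L.
move=> /vertex_lexmax[E [c [v [oE L ->]]]].
have Ee := outer_normal_edge oE; have [c' oE' L'] := fP _ Ee.
have [c0 cn _ _] := oE.
apply/mapP; exists E; first by rewrite mem_enum inE; exact/asboolP.
(* The vertex does not depend on which normal of [E] was chosen. *)
have [l [l0 ec]] := outer_normal_unique oE' oE.
by apply: lexmax_unique L _ => //; rewrite ec; exact: lexmaxZ.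
Qed.

End VertexCount.

(** Generators are pairs of a summand and a position in its list; a linear bound on the listed
    points passes to convex combinations. *)
Lemma conv_generators (R : realType) (m : nat) (s : 'I_m -> seq 'rV[R]_3) :
  generates (fun i => conv (s i))
    (fun t : {i : 'I_m & 'I_(size (s i))} => (s (tag t))`_(tagged t)) (@tag _ _).
Proof.
split=> [[i j]|i c r h y [w [w0 [w1 ->]]]] /=.
  exists (fun k => (k == j)%:R); split; first by move=> k; rewrite ler0n.
  split; rewrite (bigD1 j) //= eqxx big1 ?addr0 ?scale1r //;
    by move=> k /negbTE->; rewrite ?scale0r.
rewrite dot_sumr -[r]mul1r -w1 mulr_suml; apply: ler_sum => j _.
by rewrite dotZr ler_wpM2l // (h (Tagged (fun i => 'I_(size (s i))) j)).
Qed.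

Unset Implicit Arguments.
Set Strict Implicit.

Theorem theorem1p3 (R : realType) (m : nat) (Ps : 'I_m -> set 'rV[R]_3) :
  (forall i, polygon (Ps i)) ->
  has_dim (msum Ps) 3 ->
  (forall i j : 'I_m, i != j ->
     ~ (exists u : 'rV[R]_3, edge_direction (Ps i) u /\ edge_direction (Ps j) u)) ->
  equiprojective (msum Ps).
Proof.
move=> poly dim3 no_shared.
have /choice[s sP] i : exists s, Ps i = conv s by have [] := poly i.
have gen := conv_generators s; rewrite -(funext sP) in gen.
(* An empty sum is the origin alone, which is not three-dimensional. *)
have m_gt0 : (0 < m)%N.
  rewrite lt0n; apply/eqP => m0; case: dim3 => + _.
  apply: (@not_dim_ge3 _ _ (const_mx 1)).
    by apply/eqP => /rowP/(_ 0); rewrite !mxE => /eqP; rewrite oner_eq0.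
  have zero x : msum Ps x -> x = 0.
    by case=> a [_ ->]; apply: big1 => i; move: (ltn_ord i); rewrite {2}m0.
  by move=> x y /zero-> /zero->; rewrite subrr dot0r.
(* The number [k], left to unification, counts the edges of the summands and cannot depend on
   [n]. *)
eexists => n n0 ng; apply: (num_vertices_proj gen) => //.
- by move=> i; have [_ []] := poly i.
- by move=> i; have [_ []] := poly i.
(* Such a face would be a facet with normal [c] orthogonal to [n], which is excluded by [ng]. *)
- move=> c c0 cn d2; apply: ng; exists (face (msum Ps) c).
  have flat x y : face (msum Ps) c x -> face (msum Ps) c y -> dot c (x - y) = 0.
    move=> [Px Mx] [Py My]; apply/eqP; rewrite dotBr subr_eq0 eq_le Mx // My //.
  by split; [split; [exists c | split=> //; exact: not_dim_ge3 flat] | exists c].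
Qed.
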